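(* Let $L:[0,T]\times\mathbb{R}^N\times\mathbb{R}^N\to\mathbb{R}\cup\{\pm\infty\}$ satisfy (L1)–(L5), let $g:\mathbb{R}^N\to\mathbb{R}\cup\{\pm\infty\}$ be proper and lower semicontinuous, and let $V$ be the value function associated with $L$ and $g$. Then for every $(t_0,x_0)\in\mathrm{dom}\,V\cap[0,T)\times\mathbb{R}^N$ there exists $v_0\in\mathbb{R}^N$ such that $dV(t_0,x_0)(1,v_0)\leq-L(t_0,x_0,v_0)$.
   Context: $\mathbb{B}_R$ is the closed ball of radius $R$ at $0$; $\mathrm{dom}\,\varphi=\{z:\varphi(z)\neq\pm\infty\}$; $\varphi$ is proper if it never equals $-\infty$ and is not identically $+\infty$. Value function: for $t_0\in[0,T)$, $V(t_0,x_0)=\inf\{g(x(T))+\int_{t_0}^TL(t,x(t),\dot x(t))\,dt\}$ over absolutely continuous $x:[t_0,T]\to\mathbb{R}^N$ with $x(t_0)=x_0$; $V(T,x_0)=g(x_0)$. $V$ is regarded as $+\infty$ outside $[0,T]\times\mathbb{R}^N$. Subderivative at $z$ with $\varphi(z)$ finite: $d\varphi(z)(v)=\liminf_{\tau\to0^+,\,y\to v}(\varphi(z+\tau y)-\varphi(z))/\tau$. (L1) $L$ is lower semicontinuous in all variables. (L2) $L(t,x,\cdot)$ is convex and proper for every $t,x$. (L3) for every $(t,x,v)$ and every $(t_n,x_n)\to(t,x)$ there exist $v_n\to v$ with $L(t_n,x_n,v_n)\to L(t,x,v)$. (L4) for every $R\geq0$ there is $C_R\geq0$ with $L(t,x,v)=+\infty$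 whenever $t\in[0,T]$, $x\in\mathbb{B}_R$, $|v|>C_R$. (L5) there are an integrable $c:[0,T]\to[0,\infty)$ and a null set $\mathcal{N}$ with $L(t,x,v)=+\infty$ whenever $t\notin\mathcal{N}$ and $|v|>c(t)(1+|x|)$. *)

(* Defs.v *)
From HB Require Import structures.
From mathcomp Require Import all_boot all_order all_algebra.
From mathcomp Require Import all_classical all_reals all_analysis.
Set Implicit Arguments. Unset Strict Implicit. Unset Printing Implicit Defensive.
Import Order.TTheory GRing.Theory Num.Theory.
Import numFieldNormedType.Exports.
Local Open Scope classical_set_scope.
Local Open Scope ring_scope.

Section defs.
Variables (R : realType) (N : nat).

Definition enorm (v : 'rV[R]_N) : R := Num.sqrt (\sum_(i < N) (v ord0 i) ^+ 2).

Definition abs_cont (a b : R) (x : R -> 'rV[R]_N) : Prop :=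
  forall e : R, 0 < e -> exists2 d : R, 0 < d &
    forall (n : nat) (ak bk : nat -> R),
      (forall k, (k < n)%N -> ak k <= bk k) ->
      (forall k, (k.+1 < n)%N -> bk k <= ak k.+1) ->
      (0 < n)%N -> a <= ak 0%N -> bk n.-1 <= b ->
      \sum_(k < n) (bk k - ak k) < d ->
      \sum_(k < n) enorm (x (bk k) - x (ak k)) < e.

Local Open Scope ereal_scope.

Definition value_fun (T : R) (L : R -> 'rV[R]_N -> 'rV[R]_N -> \bar R)
  (g : 'rV[R]_N -> \bar R) (t0 : R) (x0 : 'rV[R]_N) : \bar R :=
  if t0 \in `[0%R, T[ then
    ereal_inf [set g (x T) +
                 \int[@lebesgue_measure R]_(t in `[t0, T]%classic) L t (x t) (derive1 x t)
              | x in [set x | abs_cont t0 T x /\ x t0 = x0]]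
  else if t0 == T then g x0 else +oo.

(* Subderivative d phi (t0,x0) (s,w), phi : R x R^N -> \bar R, phi(t0,x0) finite:
   liminf_{tau -> 0+, (s',y) -> (s,w)} (phi(t0 + tau s', x0 + tau y) - phi(t0,x0)) / tau,
   written out as sup over e > 0 of the inf over the e-neighbourhood. *)
Definition subderiv (phi : R -> 'rV[R]_N -> \bar R) (t0 : R) (x0 : 'rV[R]_N)
  (s : R) (w : 'rV[R]_N) : \bar R :=
  ereal_sup [set ereal_inf
     [set (phi (t0 + q.1.1 * q.1.2)%R (x0 + q.1.1 *: q.2)%R - phi t0 x0) * (q.1.1^-1)%:E
       | q in [set q : R * R * 'rV[R]_N |
                 let: (tau, s', y) := q in
                 [/\ 0 < tau < e, `|s' - s| < e & enorm (y - w) < e]%R]]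
       | e in [set e : R | (0 < e)%R]].

End defs.

(* Main.v *)
Require Import Defs.
From HB Require Import structures.
From mathcomp Require Import all_boot all_order all_algebra.
From mathcomp Require Import all_classical all_reals all_analysis.
From mathcomp Require Import measurable_realfun ring lra.

(** Fix [h > 0] small, a trajectory [x] from [(t0, x0)] whose cost exceeds
    [V t0 x0] by at most [h ^ 2], and its mean velocity
    [v = (x (t0 + h) - x0) / h]. Restarting [x] at time [t0 + h] shows
    [(V (t0 + h) (x0 + h v) - V t0 x0) / h <= h - (1 / h) int_t0^(t0+h) L].
    By (L4) admissible velocities near [x0] are bounded, so [v] is bounded and
    has a cluster point [v0] as [h] tends to [0]. For every [a < L t0 x0 v0] the
    convex lower semicontinuous function [L t0 x0] has an affine minorant with
    value [a] at [v0]; by compactness it remains a minorant of [L t y] for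
    [(t, y)] near [(t0, x0)], and integrating it along [x] bounds the mean of
    [L] from below by [a + p . (v - v0)], which tends to [a].

    Integrating the minorant requires the fundamental theorem of calculus for
    absolutely continuous functions. The total variation of such a function is
    absolutely continuous too, hence its Lebesgue-Stieltjes measure has a density
    with respect to the Lebesgue measure, and the Lebesgue differentiation
    theorem identifies the density with the derivative. *)

Set Implicit Arguments.
Unset Strict Implicit.
Unset Printing Implicit Defensive.
Import Order.TTheory GRing.Theory Num.Theory.
Import numFieldNormedType.Exports.
Local Open Scope classical_set_scope.
Local Open Scope ring_scope.

(** * Integrals of possibly non-measurable functions *)

(* The library integral of a nonnegative function is the supremum of the integrals
   of the simple functions below it, whether or not the function is measurable.
   Working with this lower integral makes it unnecessary to establish that
   [t |-> L t (x t) (x' t)] is measurable. *)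
Section lower_integral.
Local Open Scope ereal_scope.
Context d (T : measurableType d) (R : realType).
Variable mu : {measure set T -> \bar R}.
Implicit Types (D A B : set T) (f g : T -> \bar R).
Import HBNNSimple.

Lemma ge0_le_lower_integral D f g :
  (forall x, D x -> 0 <= f x) -> (forall x, D x -> f x <= g x) ->
  \int[mu]_(x in D) f x <= \int[mu]_(x in D) g x.
Proof.
move=> f0 fg.
have g0 x : D x -> 0 <= g x by move=> Dx; exact: le_trans (f0 _ Dx) (fg _ Dx).
rewrite !ge0_integralE//; apply: ereal_sup_le => _ [h hf <-]; exists h => //= x.
apply: le_trans (hf x) _; rewrite /patch; case: ifPn => // /set_mem; exact: fg.
Qed.

Lemma le_lower_integral D f g : (forall x, D x -> f x <= g x) ->
  \int[mu]_(x in D) f x <= \int[mu]_(x in D) g x.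
Proof.
move=> fg; rewrite integralE [leRHS]integralE; apply: leeB.
  apply: ge0_le_lower_integral => // x Dx.
  by rewrite !funeposE ge_max !le_max fg// lexx orbT.
apply: ge0_le_lower_integral => // x Dx.
by rewrite !funenegE ge_max !le_max leeN2 fg// lexx orbT.
Qed.

Lemma ge0_lower_integralS A B f : (forall x, B x -> 0 <= f x) -> A `<=` B ->
  \int[mu]_(x in A) f x <= \int[mu]_(x in B) f x.
Proof.
move=> f0 AB; rewrite integral_mkcond [leRHS]integral_mkcond.
apply: ge0_le_lower_integral => x _.
  by apply: erestrict_ge0 => y Ay; exact/f0/AB.
rewrite /patch; case: ifPn => [/set_mem/AB/mem_set ->//|_].
by case: ifPn => // /set_mem/f0.
Qed.

(** For [<=], a simple function below [f] splits into its restrictions to [A] and [B]. For [>=],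
    simple functions below [f] on [A] and on [B] add up to one below [f] on the union; finiteness
    lets the two suprema be taken in turn by subtraction. *)
Lemma ge0_lower_integral_setU A B f : measurable A -> measurable B ->
  [disjoint A & B] -> (forall x, (A `|` B) x -> 0 <= f x) ->
  \int[mu]_(x in A `|` B) f x < +oo ->
  \int[mu]_(x in A `|` B) f x = \int[mu]_(x in A) f x + \int[mu]_(x in B) f x.
Proof.
move=> mA mB AB f0 foo.
have fA0 x : A x -> 0 <= f x by move=> Ax; apply: f0; left.
have fB0 x : B x -> 0 <= f x by move=> Ax; apply: f0; right.
have IA : \int[mu]_(x in A) f x \is a fin_num.
  rewrite ge0_fin_numE ?integral_ge0//; apply: le_lt_trans foo.
  exact/ge0_lower_integralS.
apply/eqP; rewrite eq_le; apply/andP; split.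
  rewrite [leLHS]ge0_integralE//; apply: ge_ereal_sup => _ [h /= hf <-].
  have -> : sintegral mu h = \int[mu]_(x in A `|` B) (h x)%:E.
    rewrite -integralT_nnsfun [RHS]integral_mkcond; apply: eq_integral => x _.
    rewrite /patch; case: ifPn => // /negP xAB.
    have := hf x; rewrite /patch ifF; last exact/negP.
    by rewrite lee_fin => hx; apply/eqP; rewrite eqe eq_le hx fun_ge0.
  rewrite ge0_integral_setU//; last 2 first.
  - exact/measurable_EFinP/measurable_funTS.
  - by move=> x _; rewrite lee_fin fun_ge0.
  apply: leeD; apply: ge0_le_lower_integral => x Dx; rewrite ?lee_fin ?fun_ge0//.
    by have := hf x; rewrite /patch mem_set//; left.
  by have := hf x; rewrite /patch mem_set//; right.
rewrite -leeBrDl// [leLHS](ge0_integralE _ fB0).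
apply: ge_ereal_sup => _ [h2 /= hB <-].
have hB' x : (h2 x)%:E <= (f \_ (A `|` B)) x.
  apply: le_trans (hB x) _; rewrite /patch.
  case: ifPn => [/set_mem Bx|_]; first by rewrite mem_set//; right.
  by case: ifPn => // /set_mem/f0.
have H2 : sintegral mu h2 \is a fin_num.
  rewrite ge0_fin_numE ?sintegral_ge0//; apply: le_lt_trans foo.
  by rewrite [leRHS]ge0_integralE//; apply: ereal_sup_ubound; exists h2.
rewrite leeBrDl// -leeBrDr// [leLHS](ge0_integralE _ fA0).
apply: ge_ereal_sup => _ [h1 /= hA <-].
rewrite leeBrDr// -sintegralD// [leRHS](ge0_integralE _ f0).
(* Disjointness enters here: at each point at most one of [h1] and [h2] is nonzero. *)
apply: ereal_sup_ubound; exists (add_nnsfun h1 h2) => //= x.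
rewrite EFinD.
have := hA x; have := hB x; rewrite /patch.
case: ifPn => [/set_mem Bx|nB]; case: ifPn => [/set_mem Ax|nA] h2x h1x.
- by move/disj_setPS : AB => /(_ x)[].
- rewrite mem_set; last by right.
  by rewrite -[leRHS]add0e leeD.
- rewrite mem_set; last by left.
  by rewrite -[leRHS]adde0 leeD.
- rewrite ifF; first by rewrite -[leRHS]adde0 leeD.
  by rewrite in_setU (negbTE nA) (negbTE nB).
Qed.

(** A finite integral forces both parts of [f] to have finite integrals, so the nonnegative case
    applies to each and no indeterminate difference arises. *)
Lemma lower_integral_setU A B f : measurable A -> measurable B ->
  [disjoint A & B] ->
  \int[mu]_(x in A `|` B) f x \is a fin_num ->
  [/\ \int[mu]_(x in A `|` B) f^\+ x < +oo,
    \int[mu]_(x in A) f x \is a fin_num, \int[mu]_(x in B) f x \is a fin_num &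
   \int[mu]_(x in A `|` B) f x = \int[mu]_(x in A) f x + \int[mu]_(x in B) f x].
Proof.
move=> mA mB AB; rewrite integralE.
have Ip0 : 0 <= \int[mu]_(x in A `|` B) f^\+ x by exact: integral_ge0.
have In0 : 0 <= \int[mu]_(x in A `|` B) f^\- x by exact: integral_ge0.
rewrite fin_numB (ge0_fin_numE Ip0) (ge0_fin_numE In0) => /andP[Ip In].
have IpA : \int[mu]_(x in A) f^\+ x < +oo.
  by apply: le_lt_trans Ip; apply: ge0_lower_integralS.
have IpB : \int[mu]_(x in B) f^\+ x < +oo.
  by apply: le_lt_trans Ip; apply: ge0_lower_integralS.
have InA : \int[mu]_(x in A) f^\- x < +oo.
  by apply: le_lt_trans In; apply: ge0_lower_integralS.
have InB : \int[mu]_(x in B) f^\- x < +oo.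
  by apply: le_lt_trans In; apply: ge0_lower_integralS.
split => //.
- by rewrite integralE fin_numB !ge0_fin_numE ?IpA ?InA//; exact: integral_ge0.
- by rewrite integralE fin_numB !ge0_fin_numE ?IpB ?InB//; exact: integral_ge0.
rewrite (ge0_lower_integral_setU mA mB AB _ Ip)//.
rewrite (ge0_lower_integral_setU mA mB AB _ In)//.
rewrite (integralE _ A f) (integralE _ B f).
rewrite oppeD; last by rewrite ge0_adde_def// inE integral_ge0.
by rewrite addeACA.
Qed.

(** Otherwise the values on [A] alone would contribute [+oo]. This is how a finite cost excludes
    inadmissible velocities almost everywhere. *)
Lemma lower_integral_pinfty_null D A f : measurable A -> A `<=` D ->
  (forall x, A x -> f x = +oo) -> \int[mu]_(x in D) f^\+ x < +oo -> mu A = 0.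
Proof.
move=> mA AD fA; apply: contraPP => /eqP A0; apply/negP; rewrite -leNgt leye_eq.
rewrite -leye_eq.
apply: (@le_trans _ _ (\int[mu]_(x in A) f^\+ x)); last first.
  exact: ge0_lower_integralS.
rewrite (eq_integral (cst +oo)) ?integral_cst//.
  by rewrite gt0_mulye// lt_neqAle eq_sym A0 measure_ge0.
by move=> x /set_mem/fA fx; rewrite funeposE fx max_l ?leey.
Qed.

(** Replacing [f] by [-oo] on [A] leaves its integral unchanged, [f] being measurable, and makes the
    inequality hold on all of [D]; monotonicity then applies to an arbitrary [g]. *)
Lemma le_lower_integral_off_null D A (f : T -> R) g : measurable D -> measurable A ->
  mu A = 0 -> mu.-integrable D (EFin \o f) ->
  (forall x, D x -> ~ A x -> (f x)%:E <= g x) ->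
  \int[mu]_(x in D) (f x)%:E <= \int[mu]_(x in D) g x.
Proof.
move=> mD mA A0 intf fg.
pose f' x := if x \in A then -oo else (f x)%:E.
have mf : measurable_fun D (EFin \o f) := measurable_int _ intf.
have mf' : measurable_fun D f'.
  apply: measurable_fun_if => //.
  - apply: (measurable_fun_bool true); rewrite (_ : _ @^-1` _ = A).
      exact: measurableI.
    by apply/seteqP; split=> x /= => [/set_mem|/mem_set].
  - exact: measurable_funS mf.
have -> : \int[mu]_(x in D) (f x)%:E = \int[mu]_(x in D) f' x.
  apply: ae_eq_integral => //.
  exists A; split => // x /=; rewrite /f'.
  by case: ifPn => [/set_mem//|_] /not_implyP[].
apply: le_lower_integral => x Dx; rewrite /f'; case: ifPn => [|nA].
  by rewrite leNye.
by apply: fg => // Ax; move: nA; rewrite mem_set.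
Qed.

End lower_integral.

(** * Absolutely continuous functions *)

Section chain.
Variable R : realType.
Implicit Types (a b c d e : R) (l m : seq (R * R)) (f : R -> R).

(* Finite families of successive subintervals of [a, b]. *)
Fixpoint chain a b l : Prop :=
  if l is p :: l' then [/\ a <= p.1, p.1 <= p.2 & chain p.2 b l'] else a <= b.

Definition chain_length l := \sum_(p <- l) (p.2 - p.1).

Definition chain_variation f l := \sum_(p <- l) `|f p.2 - f p.1|.

Lemma chain_le a b l : chain a b l -> a <= b.
Proof.
by elim: l a => //= p l IH a [ap pp /IH pb]; rewrite (le_trans ap)// (le_trans pp).
Qed.

Lemma chainW a b a' b' l : a' <= a -> b <= b' -> chain a b l -> chain a' b' l.
Proof.
move=> a'a bb'; elim: l a a' a'a => [|p l IH] a a' a'a /=.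
  by move=> ab; rewrite (le_trans a'a)// (le_trans ab).
by move=> [ap pp pb]; split => //; [exact: le_trans ap|exact: IH pb].
Qed.

Lemma chain_cat a b c l m : chain a c l -> chain c b m -> chain a b (l ++ m).
Proof.
elim: l a => [|p l IH] a /=; first by move=> ac; exact: chainW.
by move=> [ap pp pc] cb; split => //; exact: IH.
Qed.

Lemma chain_nth a b l : chain a b l ->
  [/\ forall k, (k < size l)%N -> (nth (0, 0) l k).1 <= (nth (0, 0) l k).2,
      forall k, (k.+1 < size l)%N -> (nth (0, 0) l k).2 <= (nth (0, 0) l k.+1).1,
      (0 < size l)%N -> a <= (nth (0, 0) l 0).1 &
      (0 < size l)%N -> (nth (0, 0) l (size l).-1).2 <= b].
Proof.
elim: l a => [|p l IH] a //= [ap pp pb].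
have [H1 H2 H3 H4] := IH _ pb.
split => //.
- by case=> [//|k]; exact: H1.
- by case=> [|k] kl /=; [exact: H3|exact: H2].
- by case: {IH H1 H2 H3} l pb H4 => //= q l pb; exact.
Qed.

Lemma chain_zip a s : path <%R a s -> chain a (last a s) (zip (a :: s) s).
Proof.
elim: s a => [|x s IH] a //= /andP[ax xs].
by split; [exact: lexx|exact: ltW|exact: IH].
Qed.

Lemma chain_length_zip a s : chain_length (zip (a :: s) s) = last a s - a.
Proof.
rewrite /chain_length; elim: s a => [|x s IH] a /=; first by rewrite big_nil subrr.
by rewrite big_cons IH /= addrC addrA subrK.
Qed.

Lemma chain_variation_zip f a b s : itv_partition a b s ->
  chain_variation f (zip (a :: s) s) = variation a b f s.
Proof.
move=> /variation_zip ->; rewrite /chain_variation.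
elim: s a => [|x s IH] a /=; first by rewrite !big_nil.
by rewrite !big_cons IH.
Qed.

(** The bound by [e] is non-strict so that it survives the passage to suprema in
    [sum_total_variation_le]. *)
Definition abs_cont_on a b f := forall e, 0 < e -> exists2 d, 0 < d &
  forall l, chain a b l -> chain_length l < d -> chain_variation f l <= e.

Lemma chain_length_cat l m : chain_length (l ++ m) = chain_length l + chain_length m.
Proof. exact: big_cat. Qed.

Lemma chain_variation_cat f l m :
  chain_variation f (l ++ m) = chain_variation f l + chain_variation f m.
Proof. exact: big_cat. Qed.

Local Notation TV := total_variation.

(* Each summand is a supremum over partitions of one interval, and inserting
   such a partition in a chain gives a chain of the same length. *)
Lemma sum_total_variation_le a b d e f :
  (forall l, chain a b l -> chain_length l < d -> chain_variation f l <= e) ->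
  forall l m c, chain a c m -> chain c b l ->
    chain_length m + chain_length l < d ->
    ((chain_variation f m)%:E + \sum_(p <- l) TV p.1 p.2 f <= e%:E)%E.
Proof.
move=> H; elim=> [|p l IH] m c cm cl.
  rewrite big_nil adde0 [chain_length [::]]big_nil addr0 => lm.
  by rewrite lee_fin; apply: H => //; exact: chainW cm.
rewrite [chain_length (_ :: _)]big_cons -/(chain_length l) => lml.
move: cl => /= [cp pp cl].
have cm' : chain a p.2 m by apply: chainW cm => //; exact: le_trans pp.
have S0 : (0 <= \sum_(q <- l) TV q.1 q.2 f)%E.
  clear -cl; elim: l p cl => [|q l IH] p /=; first by rewrite big_nil.
  by move=> [_ qq /IH ?]; rewrite big_cons adde_ge0// total_variation_ge0.
have lmd : chain_length m + chain_length l < d.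
  by apply: le_lt_trans lml; rewrite lerD2l lerDr subr_ge0.
(* The induction hypothesis bounds the remaining variations, so they are finite and can be moved
   across the inequality. *)
have Sfin : (\sum_(q <- l) TV q.1 q.2 f)%E \is a fin_num.
  rewrite ge0_fin_numE//.
  have := IH _ _ cm' cl lmd; rewrite -leeBrDl// => /le_lt_trans; apply.
  by rewrite -EFinB ltry.
rewrite big_cons addeCA -leeBrDr ?fin_numD ?Sfin//.
apply: ge_ereal_sup => _ [_ [s ps <-] <-].
rewrite leeBrDr ?fin_numD ?Sfin// addeA -EFinD.
rewrite -(chain_variation_zip _ ps) (addrC (chain_variation _ _)) -chain_variation_cat.
have [s1 /eqP s2] := ps.
apply: (IH _ p.2 _ cl).
  apply: chain_cat (chainW _ _ cm) _; [exact: lexx|exact: cp|].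
  by rewrite -[in X in chain _ X]s2; exact: chain_zip.
by rewrite chain_length_cat chain_length_zip s2 -addrA.
Qed.

(** On an interval shorter than [d] the variation is at most 1, and finitely many steps of length
    [d / 2] lead from [a] to [b]. *)
Lemma abs_cont_on_bounded_variation a b f : a <= b -> abs_cont_on a b f ->
  bounded_variation a b f.
Proof.
move=> ab /(_ 1 ltr01)[d d0 H]; apply/bounded_variationP => //.
have TVle c c' : a <= c -> c <= c' -> c' <= b -> c' - c < d ->
    (TV c c' f <= 1%:E)%E.
  move=> ac cc' c'b cd.
  have := sum_total_variation_le H (l := [:: (c, c')]) (m := [::]) (c := a).
  rewrite /chain_length /chain_variation !big_cons !big_nil/= add0r addr0.
  by rewrite add0e adde0; apply.
have TVoo n c : a <= c -> c <= b -> c - a <= n%:R * (d / 2) -> (TV a c f < +oo)%E.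
  elim: n c => [|n IH] c ac cb.
    rewrite mul0r subr_le0 => ca.
    have <- : a = c by apply/eqP; rewrite eq_le ac ca.
    by rewrite total_variationxx.
  have [nc _|nc] := leP (c - a) (n%:R * (d / 2)); first exact: IH.
  move=> cn; have nd0 : 0 <= n%:R * (d / 2) by rewrite mulr_ge0// divr_ge0// ltW.
  (* The previous point is [c - d / 2], or [a] if that would fall outside the interval. *)
  have c'c : c - Num.min (d / 2) (c - a) <= c.
    by rewrite lerBlDr lerDl le_min subr_ge0 ac andbT divr_ge0// ltW.
  have ac' : a <= c - Num.min (d / 2) (c - a).
    by rewrite lerBrDr addrC -lerBrDr ge_min lexx orbT.
  rewrite (total_variationD _ ac' c'c) lte_add_pinfty//.
    apply: IH => //; first exact: le_trans c'c cb.
    move: cn; rewrite -natr1 mulrDl mul1r.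
    by rewrite minEle; case: ifP => _ cn; [lra|rewrite subKr subrr].
  apply: (@le_lt_trans _ _ 1%:E); last exact: ltry.
  apply: TVle => //; rewrite subKr gt_min ltr_pdivrMr// ltr_pMr//.
  by rewrite (_ : 1 < 2)// ltr1n.
rewrite ge0_fin_numE ?total_variation_ge0//.
apply: (TVoo (Num.bound ((b - a) / (d / 2)))) => //.
by rewrite -ler_pdivrMr ?divr_gt0// ltW// archi_boundP// divr_ge0 ?subr_ge0// divr_ge0// ltW.
Qed.

Lemma abs_cont_on_total_variation a b f : a <= b -> abs_cont_on a b f ->
  forall c d, a <= c -> c <= d -> d <= b ->
  [/\ TV c d f \is a fin_num, `|f d - f c| <= fine (TV c d f) &
  fine (TV c d f) = fine (TV a d f) - fine (TV a c f)].
Proof.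
move=> ab acf c d ac cd db.
have bvf := abs_cont_on_bounded_variation ab acf.
have ad : a <= d by rewrite (le_trans ac cd).
have cb : c <= b := le_trans cd db.
have bad : bounded_variation a d f := bounded_variationl ad db bvf.
have fac : TV a c f \is a fin_num.
  by apply/bounded_variationP => //; exact: bounded_variationl bvf.
have fcd : TV c d f \is a fin_num.
  by apply/bounded_variationP => //; exact: bounded_variationr bad.
split => //; first by rewrite -lee_fin fineK// total_variation_ge.
by rewrite (total_variationD f ac cd) fineD// addrC addKr.
Qed.

(** By additivity, the increments of the total variation along a chain are the total variations over
    its links, whose sum is bounded by [sum_total_variation_le]. *)
Lemma abs_cont_on_fine_total_variation a b f : a <= b -> abs_cont_on a b f ->
  abs_cont_on a b (fun t => fine (TV a t f)).
Proof.
move=> ab acf e e0; have [d d0 H] := acf e e0; exists d => // l cl ld.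
have := sum_total_variation_le H (m := [::]) (c := a) (l := l).
rewrite /chain_length /chain_variation !big_nil add0r add0e.
move=> /(_ (lexx a) cl ld); rewrite -lee_fin; apply: le_trans.
rewrite -sumEFin le_eqVlt; apply/orP; left; apply/eqP.
suff : forall a', a <= a' -> chain a' b l ->
    (\sum_(i <- l) `|fine (TV a i.2 f) - fine (TV a i.1 f)|%:E =
     \sum_(p <- l) TV p.1 p.2 f)%E by move=> /(_ a (lexx a) cl).
elim: l {cl ld} => [|p l IH] a' aa'.
  by rewrite !big_nil.
move=> /= [a'p pp pb]; have pb' := chain_le pb.
have ap := le_trans aa' a'p.
rewrite !big_cons (IH p.2)//; last exact: le_trans pp.
congr (_ + _)%E.
have [fp ? <-] := abs_cont_on_total_variation ab acf ap pp pb'.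
by rewrite ger0_norm ?fineK// fine_ge0// total_variation_ge0.
Qed.

Lemma abs_cont_onB a b f g : abs_cont_on a b f -> abs_cont_on a b g ->
  abs_cont_on a b (f \- g).
Proof.
move=> acf acg e e0; have e20 : 0 < e / 2 by rewrite divr_gt0.
have [d d0 H] := acf _ e20; have [d' d'0 H'] := acg _ e20.
exists (Num.min d d'); first by rewrite lt_min d0.
move=> l cl; rewrite lt_min => /andP[ld ld'].
rewrite [leRHS]splitr (le_trans _ (lerD (H _ cl ld) (H' _ cl ld')))//.
rewrite /chain_variation -big_split/=; apply: ler_sum => p _.
suff -> : f p.2 - g p.2 - (f p.1 - g p.1) = (f p.2 - f p.1) - (g p.2 - g p.1).
  exact: ler_normB.
by ring.
Qed.

(** A coordinate increment is at most the Euclidean norm of the increment. The empty chain is set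
    apart because [abs_cont] speaks of nonempty families. *)
Lemma abs_cont_on_coord (N : nat) a b (x : R -> 'rV[R]_N) (i : 'I_N) :
  abs_cont a b x -> abs_cont_on a b (fun t => x t ord0 i).
Proof.
move=> acx e e0; have [d d0 H] := acx e e0; exists d => // l cl ld.
have [->|l0] := eqVneq l [::]; first by rewrite /chain_variation big_nil ltW.
have {}l0 : (0 < size l)%N by case: l l0 {cl ld}.
have [H1 H2 H3 H4] := chain_nth cl.
move: ld; rewrite /chain_length (big_nth (0, 0)) big_mkord => ld.
have := H (size l) (fun k => (nth (0, 0) l k).1) (fun k => (nth (0, 0) l k).2).
move=> /(_ H1 H2 l0 (H3 l0) (H4 l0) ld) /ltW; apply: le_trans.
rewrite /chain_variation (big_nth (0, 0)) big_mkord; apply: ler_sum => k _.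
rewrite -sqrtr_sqr ler_sqrt; last by apply: sumr_ge0 => j _; exact: sqr_ge0.
rewrite (bigD1 i)//= !mxE lerDl; apply: sumr_ge0 => j _; exact: sqr_ge0.
Qed.

End chain.

(** * Densities and the fundamental theorem of calculus *)

Section density.
Variable R : realType.
Implicit Types (a b c d e : R) (f G : R -> R).
Notation mu := (@lebesgue_measure R).

Lemma chain_grid (t : nat -> R) (P : pred nat) m k :
  (forall i, t i <= t i.+1) ->
  chain (t m) (t (m + k)%N) [seq (t i, t i.+1) | i <- iota m k & P i].
Proof.
move=> tS; elim: k m => [|k IH] m /=; first by rewrite addn0.
have := IH m.+1; rewrite addSnnS; case: ifP => _ /= H; first by split.
by apply: chainW H.
Qed.

Lemma grid_cover (t : nat -> R) m x : t 0%N < x -> x <= t m ->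
  exists2 i, (i < m)%N & t i < x <= t i.+1.
Proof.
move=> t0x; elim: m => [|m IH] xt; first by move: t0x; rewrite ltNge xt.
have [/IH[i im ix]|tx] := leP x (t m); first by exists i => //; exact: ltnW.
by exists m => //; rewrite tx xt.
Qed.

(* [U] is exhausted from inside by unions of cells of finer and finer uniform
   grids, and the cells contained in [U] form a chain of length at most [mu U]. *)
Lemma abs_cont_on_null a b G (nu : {measure set (measurableTypeR R) -> \bar R}) :
  a < b -> {in `[a, b] &, nondecreasing_fun G} -> abs_cont_on a b G ->
  (forall c d, a <= c -> c <= d -> d <= b -> nu `]c, d]%classic = (G d - G c)%:E) ->
  forall A : set R, measurable A -> mu A = 0%E -> nu (A `&` `]a, b]) = 0%E.
Proof.
move=> ab ndG acG nuG A mA A0.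
apply/eqP; rewrite eq_le measure_ge0 andbT.
apply/lee_addgt0Pr => e e0; rewrite add0e.
have [d d0 H] := acG e e0.
have Aoo : (mu A < +oo)%E by rewrite A0.
have [U [oU AU UA]] := lebesgue_regularity_outer mA Aoo d0.
have mU : measurable U by exact: open_measurable.
have Ud : (mu U < d%:E)%E.
  apply: (@le_lt_trans _ _ (mu A + mu (U `\` A))%E); last by rewrite A0 add0e.
  by rewrite -{1}(setDUK AU); apply: measureU2 => //; exact: measurableD.
pose t n i := a + (b - a) * i%:R / n.+1%:R.
have t0 n : t n 0%N = a by rewrite /t mulr0 mul0r addr0.
have tn n : t n n.+1 = b by rewrite /t mulfK ?pnatr_eq0// addrC subrK.
have tS n i : t n i.+1 - t n i = (b - a) / n.+1%:R.
  rewrite /t opprD addrACA subrr add0r -mulrBl -mulrBr -natrB//.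
  by rewrite subSnn mulr1.
have tle n i : t n i <= t n i.+1.
  by rewrite -subr_ge0 tS divr_ge0// subr_ge0 ltW.
have tmon n : {homo t n : i j / (i <= j)%N >-> i <= j}.
  by apply: homo_leq => //; exact: le_trans.
pose F n i : set R := `]t n i, t n i.+1]%classic.
pose sel n i := `[< F n i `<=` U >].
pose Un n := \big[setU/set0]_(i < n.+1 | sel n i) F n i.
have mF n i : measurable (F n i) by exact: measurable_itv.
have tF n : trivIset setT (fun i : 'I_n.+1 => F n i).
  move=> i j _ _ [y []]; rewrite /F /= !in_itv/= => /andP[iy yi] /andP[jy yj].
  apply/val_inj/eqP; rewrite eqn_leq; apply/andP; split; rewrite leqNgt; apply/negP.
    by move=> /tmon/(le_trans yj)/(lt_le_trans iy); rewrite ltxx.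
  by move=> /tmon/(le_trans yi)/(lt_le_trans jy); rewrite ltxx.
have mUn n : measurable (Un n) by apply: bigsetU_measurable.
have tab n (i : 'I_n.+1) : a <= t n i /\ t n i.+1 <= b.
  by rewrite -{1}(t0 n) -(tn n); split; exact: tmon.
have nuUn n : (nu (Un n) <= e%:E)%E.
  pose l := [seq (t n i, t n i.+1) | i <- iota 0 n.+1 & sel n i].
  have cl : chain a b l.
    by rewrite -(t0 n) -{1}(tn n) -[n.+1]add0n; exact: chain_grid.
  rewrite measure_bigsetU_ord//; last by move=> i; exact: mF.
  rewrite (eq_bigr (fun i : 'I_n.+1 => `|G (t n i.+1) - G (t n i)|%:E)); last first.
    move=> i _; have [ai ib] := tab n i; apply: etrans (nuG _ _ ai (tle n i) ib) _.
    congr EFin; rewrite ger0_norm// subr_ge0.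
    apply: ndG => //; rewrite in_itv/= ?ib ?ai ?(le_trans ai)//.
    by rewrite (le_trans (tle _ _)).
  rewrite sumEFin lee_fin.
  have := H _ cl.
  rewrite /chain_length /chain_variation !big_map !big_filter.
  rewrite -[iota 0 _]/(index_iota 0 n.+1) !big_mkord; apply.
  rewrite -lte_fin; apply: le_lt_trans Ud.
  rewrite -sumEFin (eq_bigr (fun i : 'I_n.+1 => mu (F n i))); last first.
    move=> i _; rewrite /F lebesgue_measure_itv/= lte_fin.
    case: ltP => //= h; rewrite (_ : t n i.+1 = t n i) ?subrr//.
    by apply/eqP; rewrite eq_le h tle.
  rewrite -(@measure_bigsetU_ord _ _ _ mu)//; last by move=> i; exact: mF.
  apply: (@le_measure _ _ _ mu); rewrite ?inE//; first exact: mUn.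
  by move=> y; rewrite -bigcup_seq_cond => -[i /= /andP[_ /asboolP iU]]; exact: iU.
(* The sets [Un n] need not increase, since the grids do not refine one another; their tail
   intersections [W n] do, and still cover the part of [A] in []a, b]]. *)
pose W n := \bigcap_(m in [set m | (n <= m)%N]) Un m.
have mW k : measurable (W k).
  by apply: bigcap_measurable => [|? _]; [exists k => /=|exact: mUn].
have ndW : nondecreasing_seq W.
  move=> i j ij; apply/subsetPset => x Wx k /= jk; apply: Wx => /=.
  exact: leq_trans jk.
have := @nondecreasing_cvg_mu _ _ _ nu W mW (bigcupT_measurable _ mW) ndW.
move=> /cvg_lim nuW.
apply: (@le_trans _ _ (nu (\bigcup_n W n))).
  apply: (@le_measure _ _ _ nu); rewrite ?inE//.
  - by apply: measurableI => //; exact: measurable_itv.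
  - exact: bigcupT_measurable.
  move=> x [/AU Ux]; rewrite /= in_itv/= => /andP[ax xb].
  have /nbhs_ballP[r /= r0 xU] : nbhs x U by apply: open_nbhs_nbhs.
  (* From this index on the cells are shorter than [r], so the cell containing [x] lies in [U]. *)
  exists (Num.bound ((b - a) / r)) => // m /= rm.
  have [i im xi] : exists2 i, (i < m.+1)%N & t m i < x <= t m i.+1.
    by apply: grid_cover; rewrite ?t0 ?tn.
  rewrite /Un -bigcup_seq_cond; exists (Ordinal im) => //=.
  rewrite mem_index_enum/=; apply/asboolP => y; rewrite /F/= in_itv/= => yi.
  apply: xU; rewrite /ball/= (@le_lt_trans _ _ (t m i.+1 - t m i))//.
    by rewrite ler_norml; lra.
  rewrite tS ltr_pdivrMr ?ltr0n// mulrC -ltr_pdivrMr//.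
  apply: (@lt_le_trans _ _ (Num.bound ((b - a) / r))%:R); last by rewrite ler_nat leqW.
  by rewrite archi_boundP// divr_ge0// ltW// subr_gt0.
rewrite -nuW//; apply: lime_le.
  apply: ereal_nondecreasing_is_cvgn => i j ij.
  apply: (@le_measure _ _ _ nu); [by rewrite inE; exact: mW..|].
  by apply/subsetPset; apply: ndW.
apply: nearW => n; apply: le_trans (nuUn n).
apply: (@le_measure _ _ _ nu); [by rewrite inE; exact: mW|by rewrite inE; exact: mUn|].
by move=> x; apply => /=.
Qed.


(** Clipping to [[a, b]] is nondecreasing and 1-Lipschitz. The extension of [G] to the whole line
    obtained in this way serves to define a Stieltjes measure. *)
Lemma abs_cont_on_clip a b G : a <= b -> abs_cont_on a b G ->
  continuous (fun t => G (Num.max a (Num.min b t))).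
Proof.
move=> ab acG t; apply/cvgrPdist_le => e e0.
have [d d0 H] := acG e e0.
have near_d c c' : a <= c -> c <= c' -> c' <= b -> c' - c < d -> `|G c' - G c| <= e.
  move=> ac cc' c'b c'c; have := H [:: (c, c')].
  by rewrite /chain_length /chain_variation !big_cons !big_nil/= !addr0; apply.
pose clip s := Num.max a (Num.min b s).
have clipP s : a <= clip s <= b by rewrite /clip le_max lexx/= ge_max ab ge_min lexx.
have clip_nd s s' : s <= s' -> clip s <= clip s'.
  by rewrite /clip => ss'; case: (leP b s) => ?; case: (leP b s') => ?; case: (leP a b) => ?;
    case: (leP a s) => ?; case: (leP a s') => ? //; lra.
have clip_lip s s' : s <= s' -> clip s' - clip s <= s' - s.
  by rewrite /clip => ss'; case: (leP b s) => ?; case: (leP b s') => ?; case: (leP a b) => ?;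
    case: (leP a s) => ?; case: (leP a s') => ? //; lra.
near=> s; have : `|t - s| < d by near: s; apply: cvgr_dist_lt.
rewrite -/(clip t) -/(clip s) => tsd.
have /andP[aS Sb] := clipP s; have /andP[aT Tb] := clipP t.
have [ts|/ltW st] := leP t s.
  rewrite distrC; apply: near_d => //; first exact: clip_nd.
  by apply: le_lt_trans (clip_lip _ _ ts) _; move: tsd; rewrite distrC ger0_norm ?subr_ge0.
apply: near_d => //; first exact: clip_nd.
by apply: le_lt_trans (clip_lip _ _ st) _; move: tsd; rewrite ger0_norm ?subr_ge0.
Unshelve. all: by end_near. Qed.

(** The Stieltjes measure of the clipped [G] vanishes on null sets by [abs_cont_on_null], so the
    Radon-Nikodym theorem provides a density. *)
Lemma nondecreasing_abs_cont_on_density a b G : a < b ->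
  {in `[a, b] &, nondecreasing_fun G} -> abs_cont_on a b G ->
  exists h : R -> R, mu.-integrable setT (EFin \o h) /\
    forall c, a <= c <= b -> (\int[mu]_(t in `]a, c]) (h t)%:E = (G c - G a)%:E)%E.
Proof.
move=> ab ndG acG.
pose clip s := Num.max a (Num.min b s).
have clipP s : clip s \in `[a, b].
  by rewrite in_itv/= /clip le_max lexx/= ge_max (ltW ab) ge_min lexx.
pose Gt s := G (clip s).
have ndGt : nondecreasing Gt.
  move=> s s' ss'; apply: ndG => //.
  by rewrite /clip; case: (leP b s) => ?; case: (leP b s') => ?; case: (leP a b) => ?;
    case: (leP a s) => ?; case: (leP a s') => ? //; lra.
have GtE s : a <= s -> s <= b -> Gt s = G s.
  by move=> sa sb; rewrite /Gt /clip min_r// max_r.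
have rcGt : right_continuous Gt.
  by apply: right_continuousW; exact: abs_cont_on_clip (ltW ab) acG.
pose Gc : cumulative R R := HB.pack Gt (isCumulative.Build R _ R Gt ndGt rcGt).
pose nu := lebesgue_stieltjes_measure Gc.
have nuE c d : a <= c -> c <= d -> d <= b -> nu `]c, d]%classic = (G d - G c)%:E.
  move=> ac cd db; rewrite /nu /lebesgue_stieltjes_measure /measure_extension.
  rewrite measurable_mu_extE/=; last exact: is_ocitv.
  rewrite wlength_itv_bnd//= !GtE//; [exact: le_trans db|exact: le_trans cd].
have mab : measurable (`]a, b]%classic : set (measurableTypeR R)).
  exact: measurable_itv.
have nuoo : (nu `]a, b]%classic < +oo)%E by rewrite nuE// ?ltry// ltW.
(* Restricting to []a, b]] gives a finite measure, as wanted for Radon-Nikodym. *)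
pose nuf := mfrestr mab nuoo.
have dom : nuf `<< mu.
  apply/null_content_dominatesP => A mA A0.
  exact: (abs_cont_on_null ab ndG acG nuE mA A0).
have [h [h0 hfin hint hE]] := radon_nikodym_sigma_finite dom.
exists (fine \o h).
have hh : EFin \o (fine \o h) = h by apply/funext => x /=; rewrite fineK.
split; first by rewrite hh.
move=> c /andP[ac cb].
rewrite -(nuE a c)// -[LHS]/(\int[mu]_(t in `]a, c]) ((EFin \o (fine \o h)) t))%E.
rewrite hh -hE; last exact: measurable_itv.
rewrite /nuf /mfrestr /mrestr; congr (nu _).
apply/seteqP; split=> x /=; first by case.
move=> xac; split => //; move: xac; rewrite !in_itv/= => /andP[-> xc].
exact: le_trans xc cb.
Qed.

(** With [F] the total variation of [f] from [a], both [F] and [F - f] are nondecreasing and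
    absolutely continuous; the density of [f] is the difference of theirs. *)
Lemma abs_cont_on_density a b f : a < b -> abs_cont_on a b f ->
  exists h : R -> R, mu.-integrable setT (EFin \o h) /\
    forall c, a <= c <= b -> (\int[mu]_(t in `]a, c]) (h t)%:E = (f c - f a)%:E)%E.
Proof.
move=> ab acf; pose F t := fine (total_variation a t f).
have acF : abs_cont_on a b F by exact: abs_cont_on_fine_total_variation (ltW ab) acf.
have FP := abs_cont_on_total_variation (ltW ab) acf.
have ndF : {in `[a, b] &, nondecreasing_fun F}.
  move=> c d; rewrite !in_itv/= => /andP[ac cb] /andP[ad db] cd.
  rewrite -subr_ge0; have [_ fd <-] := FP _ _ ac cd db.
  exact: le_trans fd.
have ndF' : {in `[a, b] &, nondecreasing_fun (F \- f)}.
  move=> c d; rewrite !in_itv/= => /andP[ac cb] /andP[ad db] cd.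
  have [_ + +] := FP _ _ ac cd db; rewrite -/(F c) -/(F d) => /= fd E.
  by move: fd; rewrite E ler_norml => /andP[_]; lra.
have [h1 [ih1 h1E]] := nondecreasing_abs_cont_on_density ab ndF acF.
have [h2 [ih2 h2E]] :=
  nondecreasing_abs_cont_on_density ab ndF' (abs_cont_onB acF acf).
exists (fun t => h1 t - h2 t); split.
  by under [EFin \o _]funext => t do rewrite /= EFinB; exact: integrableB.
move=> c acb; have mac : measurable (`]a, c]%classic : set R) by exact: measurable_itv.
transitivity (\int[mu]_(t in `]a, c]) ((h1 t)%:E - (h2 t)%:E))%E; first by [].
rewrite integralB_EFin//; [|exact: integrableS ih1|exact: integrableS ih2].
by rewrite h1E// h2E// -EFinB /=; congr EFin; ring.
Qed.

Lemma abs_cont_on_FTC a b f : a < b -> abs_cont_on a b f ->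
  exists (h : R -> R) (Z : set R), [/\ mu.-integrable setT (EFin \o h),
    forall c, a <= c <= b -> (\int[mu]_(t in `]a, c]) (h t)%:E = (f c - f a)%:E)%E,
    measurable Z, mu Z = 0%E &
    forall t, a < t < b -> ~ Z t -> derivable f t 1 /\ derive1 f t = h t].
Proof.
move=> ab acf; have [h [ih hE]] := abs_cont_on_density ab acf.
have ihy y : mu.-integrable [set` Interval (BRight a) (BRight y)] (EFin \o h).
  exact: integrableS ih.
have loch : locally_integrable setT h by exact: open_integrable_locally openT ih.
have [Z [mZ Z0 ZP]] := FTC1 ihy loch.
exists h, Z; split => // t /andP[at_ tb] Zt.
pose F x := (\int[mu]_(s in `]a, x]) (h s))%R.
have [dF FE] : derivable F t 1 /\ derive1 F t = h t.
  by apply: contrapT => nF; apply: Zt; apply: ZP => /= H; apply: nF; apply: H.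
(* Near an interior point [f] differs from the integral of [h] by a constant, so it inherits the
   derivative. *)
have nfF : \forall x \near t, f x = F x + f a.
  near=> x; rewrite /F /Rintegral hE ?subrK//=.
  by apply/andP; split; apply/ltW; near: x; [exact: lt_nbhsr|exact: lt_nbhsl].
have isF : is_derive t 1 F (h t) by apply: DeriveDef => //; rewrite -derive1E.
have : is_derive t 1 f (h t).
  apply: (@near_eq_is_derive _ _ _ (F \+ cst (f a))).
    by apply: filterS nfF => x ->.
  by rewrite -[h t]addr0; exact: is_deriveD.
by move=> [df dE]; split => //; rewrite derive1E.
Unshelve. all: by end_near. Qed.

End density.

(** * Affine minorants *)

Section affine_minorants.
Variable R : realType.

Lemma lte_EFin_between (x y : \bar R) : (x < y)%E ->
  exists r : R, (x < r%:E < y)%E.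
Proof.
case: x y => [x| |] [y| |]; rewrite ?ltxx ?ltNge ?leey ?leNye//= -?ltNge.
- by rewrite lte_fin => xy; exists ((x + y) / 2); rewrite !lte_fin !midf_lt.
- by exists (x + 1); rewrite ltry lte_fin ltrDl ltr01.
- by exists (y - 1); rewrite ltNyr lte_fin ltrBlDr ltrDl ltr01.
- by exists 0; rewrite ltry ltNyr.
Qed.

(** The sublevel sets [A y] are nested, hence form a filter base on [K]. A cluster point [x] is a
    minimiser: a real strictly between a smaller value [f y] and [f x] would, by lower
    semicontinuity, stay below [f] near [x], where [A y] has points. *)
Lemma compact_argmin (X : topologicalType) (K : set X) (f : X -> \bar R) :
  compact K -> K !=set0 ->
  (forall x, K x -> forall a : R, (a%:E < f x)%E -> \forall y \near x, (a%:E < f y)%E) ->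
  exists2 x, K x & forall y, K y -> (f x <= f y)%E.
Proof.
move=> cK [x0 Kx0] lscf.
pose A y := [set x | K x /\ (f x <= f y)%E].
have FF : ProperFilter (filter_from K A).
  apply: filter_from_proper; last by move=> y Ky; exists y; split.
  apply: filter_from_filter; first by exists x0.
  move=> y z Ky Kz; have [yz|/ltW zy] := leP (f y) (f z).
    by exists y => // x [Kx xy]; split; split => //; exact: le_trans yz.
  by exists z => // x [Kx xz]; split; split => //; exact: le_trans zy.
have [|x [Kx clx]] := cK _ FF; first by exists x0 => // x [].
exists x => // y Ky; rewrite leNgt; apply/negP => /lte_EFin_between[r /andP[yr rx]].
have [|z [[_ zy] rz]] := clx (A y) _ _ (lscf _ Kx _ rx); first by exists y.
by move: (lt_trans rz (le_lt_trans zy yr)); rewrite ltxx.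
Qed.

Variable N : nat.
Implicit Types (v w p : 'rV[R]_N) (l : 'rV[R]_N -> \bar R).

Definition dot v w : R := \sum_(i < N) v ord0 i * w ord0 i.

Lemma dot_cvg (f g : 'rV[R]_N -> 'rV[R]_N) w :
  {for w, continuous f} -> {for w, continuous g} ->
  {for w, continuous (fun v => dot (f v) (g v))}.
Proof.
move=> cf cg; rewrite /dot /prop_for /continuous_at.
elim: (index_enum _) => [|i r IH].
  rewrite (_ : (fun _ => _) = cst 0); last by apply/funext => v; rewrite big_nil.
  by rewrite big_nil; exact: (@cvg_cst R (0 : R) _ (nbhs w) _).
rewrite (_ : (fun _ => _) = fun v => f v ord0 i * g v ord0 i +
    \sum_(j <- r) f v ord0 j * g v ord0 j); last by apply/funext => v; rewrite big_cons.
rewrite big_cons.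
apply: cvgD IH; apply: cvgM.
  by apply: (@cvg_comp _ _ _ f (fun M => M ord0 i) _ _ _ cf); apply: coord_continuous.
by apply: (@cvg_comp _ _ _ g (fun M => M ord0 i) _ _ _ cg); apply: coord_continuous.
Qed.

Lemma subr_cst_continuous v0 w : {for w, continuous (fun v => v - v0)}.
Proof.
exact: (@cvgB _ _ _ (nbhs w) _ (fun v => v) (fun=> v0) w v0 cvg_id
  (@cvg_cst _ v0 _ (nbhs w) _)).
Qed.

Lemma box_compact (C : R) : compact [set v : 'rV[R]_N | forall i, `|v ord0 i| <= C].
Proof.
rewrite (_ : [set v | _] = [set v : 'rV[R]_N | forall i, `[- C, C]%classic (v ord0 i)]).
  exact: (@rV_compact R N (fun=> `[- C, C]%classic)
    (fun=> @segment_compact R (- C) C)).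
by apply/seteqP; split=> v /= vC i; have := vC i; rewrite in_itv/= ler_norml.
Qed.

Lemma dotDr p v w : dot p (v + w) = dot p v + dot p w.
Proof. by rewrite /dot -big_split/=; apply: eq_bigr => i _; rewrite mxE mulrDr. Qed.

Lemma dotZr p c w : dot p (c *: w) = c * dot p w.
Proof. by rewrite /dot mulr_sumr; apply: eq_bigr => i _; rewrite mxE; ring. Qed.

Lemma dotBr p v w : dot p (v - w) = dot p v - dot p w.
Proof. by rewrite -scaleN1r dotDr dotZr mulN1r. Qed.

Lemma dotC v w : dot v w = dot w v.
Proof. by apply: eq_bigr => i _; rewrite mulrC. Qed.

Lemma dot_ge0 v : 0 <= dot v v.
Proof. by apply: sumr_ge0 => i _; rewrite -expr2 sqr_ge0. Qed.

Lemma dot_line v w c : dot (v + c *: w) (v + c *: w) =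
  dot v v + 2 * c * dot v w + c ^+ 2 * dot w w.
Proof.
rewrite !(dotDr, dotZr) (dotC _ v) (dotC _ w) !(dotDr, dotZr) (dotC w v).
by ring.
Qed.

(* The affine minorant comes from the minimiser [wk] of [l + k |. - v0|^2]:
   for [k] large the minimum exceeds [a], and first-order optimality together
   with convexity yields the slope [p = 2 k (v0 - wk)]. This also covers the
   case [l v0 = +oo]. *)
Lemma affine_minorant l (C a : R) v0 :
  (forall v, l v != -oo%E) -> (exists v, l v != +oo%E) ->
  (forall v w (lam : R), 0 < lam < 1 ->
    (l (lam *: v + (1 - lam) *: w)%R <= lam%:E * l v + (1 - lam)%:E * l w)%E) ->
  (forall v (r : R), (r%:E < l v)%E -> \forall w \near v, (r%:E < l w)%E) ->
  (forall v, (exists i, C < `|v ord0 i|) -> l v = +oo%E) ->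
  (a%:E < l v0)%E ->
  exists p, forall w, ((a + dot p (w - v0))%:E < l w)%E.
Proof.
move=> lNy [w1 lw1] cvxl lscl lC av0.
pose K := [set v : 'rV[R]_N | forall i, `|v ord0 i| <= C].
have cK : compact K := @box_compact C.
have finl v : l v != +oo%E -> l v = (fine (l v))%:E.
  by move=> lv; rewrite fineK// fin_numE lNy lv.
have Kl v : l v != +oo%E -> K v.
  move=> lv i; rewrite leNgt; apply/negP => Ci; move/eqP : lv; apply.
  by apply: lC; exists i.
have K1 := Kl _ lw1.
have [wm Km wmP] := compact_argmin cK (ex_intro _ w1 K1) (fun x _ r h => lscl x r h).
have lwm : l wm != +oo%E.
  by apply/eqP => wmy; have := wmP _ K1; rewrite wmy leye_eq; exact/negP.
have m0P w : ((fine (l wm))%:E <= l w)%E.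
  rewrite -finl//; have [->|lw] := eqVneq (l w) +oo%E; first by rewrite leey.
  exact/wmP/Kl.
set m0 := fine (l wm) in m0P.
have /nbhs_ballP[r /= r0 ballU] := lscl _ _ av0.
(* With this [k], wherever some coordinate is at least [r] away from that of [v0], the penalised
   function is at least [m0 + |m0| + |a| + 1 > a]. *)
pose k := (`|a| + `|m0| + 1) / r ^+ 2.
have k0 : 0 <= k by rewrite divr_ge0// ?sqr_ge0// !addr_ge0.
pose q w := dot (w - v0) (w - v0).
have q_lsc x b : (b%:E < l x + (k * q x)%:E)%E ->
    \forall w \near x, (b%:E < l w + (k * q w)%:E)%E.
  rewrite -lteBlDr// -EFinB => /lte_EFin_between[c /andP[]].
  rewrite lte_fin ltrBlDr -ltrBlDl => bc cx.
  have cq : (fun w => k * q w) @ x --> k * q x.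
    have cq : q @ x --> q x.
      by apply: (@dot_cvg (fun v => v - v0) (fun v => v - v0)); exact: subr_cst_continuous.
    exact: (@cvgM _ _ (nbhs x) _ (fun=> k) q k (q x) (@cvg_cst _ k _ (nbhs x) _) cq).
  near=> w.
  have cw : (c%:E < l w)%E by near: w; exact: lscl.
  have bw : b - c < k * q w by near: w; exact: (cvgr_gt _ cq).
  rewrite -lteBlDr// -EFinB; apply: lt_trans cw; rewrite lte_fin; lra.
have [wk Kk wkP] := compact_argmin cK (ex_intro _ w1 K1) (fun x _ b h => q_lsc x b h).
have lwk : l wk != +oo%E.
  apply/eqP => wmy; have := wkP _ K1; rewrite wmy (finl _ lw1) addye// leye_eq.
set lk := fine (l wk).
have lkE : l wk = lk%:E by rewrite finl.
(* Inside the ball [l] alone exceeds [a]; outside it the penalty makes up the difference. *)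
have big : a < lk + k * q wk.
  have [wkb|wkb] := pselect (ball v0 r wk).
    apply: (@lt_le_trans _ _ lk); last by rewrite lerDl mulr_ge0// dot_ge0.
    by rewrite -lte_fin -lkE; exact: ballU.
  have m0k : m0 <= lk by rewrite -lee_fin -lkE.
  have qr : r ^+ 2 <= q wk.
    have [i ri] : exists i, r <= `|v0 ord0 i - wk ord0 i|.
      apply: contrapT => nri; apply: wkb; split => // i0 i; rewrite ord1.
      by rewrite /ball/= ltNge; apply/negP => ri; apply: nri; exists i.
    rewrite /q /dot (bigD1 i)//= ler_wpDr//.
      by apply: sumr_ge0 => j _; rewrite -expr2 sqr_ge0.
    rewrite !mxE -expr2 -(real_normK (num_real (wk ord0 i - v0 ord0 i))) distrC.
    by rewrite ler_sqr// nnegrE ltW.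
  have : k * r ^+ 2 <= k * q wk by rewrite ler_wpM2l.
  rewrite divfK ?gt_eqF ?exprn_gt0//.
  by have := ler_norm a; have := ler_norm (- m0); rewrite normrN; lra.
exists (- (2 * k) *: (wk - v0)) => w.
have [->|lw] := eqVneq (l w) +oo%E; first by rewrite ltry.
rewrite (finl _ lw) lte_fin; set lwr := fine (l w).
have lwE : l w = lwr%:E by rewrite finl.
pose B := dot (wk - v0) (w - wk); pose Q := dot (w - wk) (w - wk).
(* The minimiser [wk] is compared with the point [z] of the segment towards [w]; convexity bounds
   [l z], and a factor [lam] is divided out. *)
have key (lam : R) : 0 < lam < 1 -> 0 <= (lwr - lk + 2 * k * B) + lam * (k * Q).
  move=> lam01; have /andP[lam0 lam1] := lam01.
  pose z := lam *: w + (1 - lam) *: wk.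
  have zle : (l z <= (lam * lwr + (1 - lam) * lk)%:E)%E.
    by apply: le_trans (cvxl _ _ _ lam01) _; rewrite lwE lkE -!EFinM -EFinD.
  have lz : l z != +oo%E by apply/eqP => lz; move: zle; rewrite lz leye_eq.
  have := wkP _ (Kl _ lz); rewrite lkE (finl _ lz) -!EFinD lee_fin.
  move: zle; rewrite (finl _ lz) lee_fin => zle.
  have -> : q z = q wk + 2 * lam * B + lam ^+ 2 * Q.
    rewrite /q (_ : z - v0 = (wk - v0) + lam *: (w - wk)) ?dot_line//.
    by apply/rowP => i; rewrite !mxE; ring.
  move=> h; rewrite -(pmulr_rge0 _ lam0); move: zle h; set t := fine _ => zle h.
  have -> : lam * (lwr - lk + 2 * k * B + lam * (k * Q)) =
    (lam * lwr + (1 - lam) * lk - lk) + k * (2 * lam * B + lam ^+ 2 * Q) by ring.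
  have : k * (q wk + 2 * lam * B + lam ^+ 2 * Q) =
    k * q wk + k * (2 * lam * B + lam ^+ 2 * Q) by ring.
  by move: h => /=; lra.
have fo : 0 <= lwr - lk + 2 * k * B.
  rewrite leNgt; apply/negP => neg.
  have kQ : 0 <= k * Q by rewrite mulr_ge0// dot_ge0.
  set D := lwr - lk + 2 * k * B in key neg.
  have den : 0 < 2 * (k * Q) - 2 * D by lra.
  (* Instead of a limit [lam -> 0], one explicit value: here [D + lam * (k * Q)] equals
     [D / 2 + lam * D], which is negative. *)
  pose lam := - D / (2 * (k * Q) - 2 * D).
  have lamE : lam * (2 * (k * Q) - 2 * D) = - D by rewrite divfK// gt_eqF.
  have lam0 : 0 < lam by rewrite divr_gt0// oppr_gt0.
  have lam1 : lam < 1 by rewrite ltr_pdivrMr//; lra.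
  have := key lam; rewrite lam0 lam1 => /(_ isT).
  have : lam * D < 0 by rewrite pmulr_rlt0.
  by move: lamE; rewrite mulrBr mulrCA (mulrCA lam 2 D); lra.
rewrite -[dot (_ *: _) _]dotC dotZr dotC.
have -> : dot (wk - v0) (w - v0) = B + q wk.
  by rewrite /B /q -dotDr; congr dot; apply/rowP => i; rewrite !mxE; ring.
(* The minorant at [w] is [a - 2 k B - 2 k q], with [q] taken at [wk], while [fo] and [big] give
   [lwr > a - 2 k B - k q]; the surplus [k q] is nonnegative. *)
have := mulr_ge0 k0 (dot_ge0 (wk - v0)); rewrite -/(q wk); nra.
Unshelve. all: by end_near. Qed.

End affine_minorants.

(** * Trajectories *)

Section trajectories.
Variables (R : realType) (N : nat).
Notation mu := (@lebesgue_measure R).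
Implicit Types (v w p : 'rV[R]_N) (x : R -> 'rV[R]_N) (F : R -> \bar R).

Lemma enorm_coord v i : `|v ord0 i| <= enorm v.
Proof.
rewrite -sqrtr_sqr ler_sqrt; last by apply: sumr_ge0 => j _; exact: sqr_ge0.
by rewrite (bigD1 i)//= lerDl; apply: sumr_ge0 => j _; exact: sqr_ge0.
Qed.

Lemma enorm_continuous : continuous (@enorm R N).
Proof.
move=> v; have -> : @enorm R N = fun w => Num.sqrt (dot w w).
  by apply/funext => w; congr Num.sqrt; apply: eq_bigr => i _; rewrite expr2.
have cdot : (fun w => dot w w) @ v --> dot v v.
  by apply: (@dot_cvg _ _ id id); exact: cvg_id.
by apply: (@cvg_comp _ _ _ _ Num.sqrt _ _ _ cdot); exact: sqrt_continuous.
Qed.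

Lemma enorm0 : enorm (0 : 'rV[R]_N) = 0.
Proof. by rewrite /enorm big1 ?sqrtr0// => i _; rewrite mxE expr0n. Qed.

Lemma enorm_near v (e : R) : 0 < e -> \forall w \near v, enorm (w - v) < e.
Proof.
move=> e0; have H : (fun w => enorm (w - v)) @ v --> enorm (v - v).
  apply: (@cvg_comp _ _ _ (fun w => w - v) (@enorm R N) _ (nbhs (v - v))).
    exact: subr_cst_continuous.
  exact: enorm_continuous.
have ve : enorm (v - v) < e by rewrite subrr enorm0.
exact: (@cvgr_lt _ _ (nbhs v) _ _ _ H _ ve).
Qed.

Lemma near_rVP v (P : set 'rV[R]_N) : nbhs v P ->
  exists2 r : R, 0 < r & forall w, (forall i, `|w ord0 i - v ord0 i| < r) -> P w.
Proof.
move=> /nbhs_ballP[r /= r0 vP]; exists r => // w wr; apply: vP; split => // j i.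
by rewrite ord1 /ball/= distrC.
Qed.

Lemma abs_cont_sub a b c d x : a <= c -> d <= b -> abs_cont a b x -> abs_cont c d x.
Proof.
move=> ac db acx e e0; have [r r0 H] := acx e e0; exists r => //.
move=> n ak bk h1 h2 h3 h4 h5; apply: H => //; first exact: le_trans h4.
exact: le_trans db.
Qed.

(** The coordinates are treated separately, and [Z] gathers their exceptional null sets. The
    intervals [[a, c[] suit the later splitting of [[t0, T]] into disjoint pieces. *)
Lemma abs_cont_FTC a b x : a < b -> abs_cont a b x ->
  exists (h : R -> 'rV[R]_N) (Z : set R), [/\
    forall i, mu.-integrable setT (fun t => (h t ord0 i)%:E),
    forall i c, a <= c <= b ->
      (\int[mu]_(t in `[a, c[) (h t ord0 i)%:E = (x c ord0 i - x a ord0 i)%:E)%E,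
    measurable Z, mu Z = 0%E &
    forall t, a < t < b -> ~ Z t -> derive1 x t = h t].
Proof.
move=> ab acx.
have /choice[h hP] : forall i : 'I_N, exists h : R -> R,
    [/\ mu.-integrable setT (EFin \o h),
    forall c, a <= c <= b -> (\int[mu]_(t in `]a, c]) (h t)%:E =
       (x c ord0 i - x a ord0 i)%:E)%E &
    {ae mu, forall t, a < t < b ->
      derivable (fun s => x s ord0 i) t 1 /\ derive1 (fun s => x s ord0 i) t = h t}].
  move=> i; have [h [Z [ih hE mZ Z0 ZP]]] := abs_cont_on_FTC ab (abs_cont_on_coord i acx).
  exists h; split => //; exists Z; split => // t /= /not_implyP[tab nd].
  by apply: contrapT => Zt; exact/nd/ZP.
have : {ae mu, forall t, forall i, a < t < b ->
    derivable (fun s => x s ord0 i) t 1 /\ derive1 (fun s => x s ord0 i) t = h i t}.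
  by apply: filter_forall => i; have [] := hP i.
move=> [Z [mZ Z0 ZP]]; exists (fun t => \row_i h i t), Z; split => //.
- by move=> i; have [ih _ _] := hP i; under eq_fun do rewrite mxE.
- move=> i c acb; have [ih hE _] := hP i.
  rewrite -hE//.
  have mi : measurable_fun setT (h i) by apply/measurable_EFinP; exact: measurable_int ih.
  transitivity (\int[mu]_(t in `[a, c[) (h i t)%:E)%E.
    by apply: eq_integral => t _; rewrite mxE.
  rewrite integral_itv_bndo_bndc; last exact/measurable_EFinP/measurable_funTS.
  by rewrite -integral_itv_obnd_cbnd//; exact/measurable_EFinP/measurable_funTS.
move=> t tab Zt.
have H i : derivable (fun s => x s ord0 i) t 1 /\
    derive1 (fun s => x s ord0 i) t = h i t.
  by apply: contrapT => nH; apply: Zt; apply: ZP => /= /(_ i tab).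
rewrite derive1E derive_mx; last by apply/derivable_mxP => i j; rewrite ord1; case: (H j).
by apply/rowP => j; rewrite !mxE -derive1E; case: (H j).
Qed.

Lemma lebesgue_measure_itvco (a b : R) : a <= b -> mu `[a, b[%classic = (b - a)%:E.
Proof.
rewrite le_eqVlt => /predU1P[->|ab]; rewrite lebesgue_measure_itv/= lte_fin.
  by rewrite ltxx subrr.
by rewrite ab.
Qed.

Lemma lebesgue_measureU0 (A B : set R) : measurable A -> measurable B ->
  mu A = 0%E -> mu B = 0%E -> mu (A `|` B) = 0%E.
Proof.
move=> mA mB A0 B0; apply/eqP; rewrite eq_le measure_ge0 andbT.
apply: le_trans (@measureU2 _ _ _ mu A B mA mB) _.
by rewrite [X in (X + _ <= _)%E]A0 [X in (_ + X <= _)%E]B0 adde0.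
Qed.

(* Jensen's inequality for an integrand with an affine minorant. *)
Lemma affine_integral_ge a b x s p v0 c F : a < b -> abs_cont a b x -> a <= s <= b ->
  (forall t, a < t < s -> ((c + dot p (derive1 x t - v0))%:E <= F t)%E) ->
  (((s - a) * (c - dot p v0) + dot p (x s - x a))%:E <= \int[mu]_(t in `[a, s[) F t)%E.
Proof.
move=> ab acx /[dup] asb /andP[as_ sb] FP.
have [h [Z [ih hE mZ Z0 ZP]]] := abs_cont_FTC ab acx.
have mD : measurable (`[a, s[%classic : set R) by exact: measurable_itv.
have ihD i : mu.-integrable `[a, s[ (fun t => (h t ord0 i)%:E).
  exact: integrableS (ih i).
have isum : mu.-integrable `[a, s[ (fun t => \sum_(i < N) (p ord0 i)%:E * (h t ord0 i)%:E)%E.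
  by apply: integrable_sum => // i _; exact: integrableZl.
have icst : mu.-integrable `[a, s[ (fun=> (c - dot p v0)%:E).
  apply: measurable_bounded_integrable => //.
    by rewrite /= lebesgue_measure_itvco// ltry.
  by exists `|c - dot p v0|; split; [exact: num_real|move=> r /ltW rr t _].
have fE t : (c + dot p (h t - v0))%:E =
    ((c - dot p v0)%:E + \sum_(i < N) (p ord0 i)%:E * (h t ord0 i)%:E)%E.
  under eq_bigr do rewrite -EFinM; rewrite sumEFin -EFinD; congr EFin.
  by rewrite dotBr -/(dot p (h t)); ring.
have iF : mu.-integrable `[a, s[ (EFin \o (fun t => c + dot p (h t - v0))).
  rewrite (_ : EFin \o _ = ((fun=> (c - dot p v0)%:E) \+
    (fun t => \sum_(i < N) (p ord0 i)%:E * (h t ord0 i)%:E))%E).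
    exact: integrableD.
  by apply/funext => t /=; rewrite fE.
(* The endpoint [a] joins [Z] because the derivative is identified only inside the interval. *)
apply: le_trans (@le_lower_integral_off_null _ _ _ mu _ (Z `|` [set a]) _ _ mD _ _ iF _).
- under eq_integral do rewrite fE.
  rewrite integralD// integral_sum//; last by move=> i; exact: integrableZl.
  rewrite integral_cst// [X in (_ * X)%E]lebesgue_measure_itvco//.
  under eq_bigr do rewrite integralZl// hE// -EFinM.
  rewrite sumEFin -EFinM -EFinD lee_fin mulrC lerD2l.
  by rewrite le_eqVlt; apply/orP; left; apply/eqP; apply: eq_bigr => i _; rewrite !mxE.
- by apply: measurableU.
- by apply: lebesgue_measureU0 => //; exact: lebesgue_measure_set1.
- move=> t /=; rewrite in_itv/= => /andP[at_ ts] /not_orP[Zt ta].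
  have at' : a < t by rewrite lt_neqAle at_ eq_sym andbT; apply/eqP.
  rewrite -ZP//; first by apply: FP; rewrite at'.
  by rewrite at' (lt_le_trans ts).
Qed.

(** A continuation argument: while [x] stays within [r] of [x a], velocities with a coordinate
    larger than [C] in absolute value cost [+oo] and occur on a null set only, which limits the
    displacement to [C * h < r]; so [x] cannot exit before time [a + h]. *)
Lemma speed_bound a b x (C r h : R) F : a < b -> abs_cont a b x ->
  0 <= C -> a + h <= b -> C * h < r ->
  (forall t, a < t < b -> (forall i, `|x t ord0 i - x a ord0 i| < r) ->
    (exists i, C < `|derive1 x t ord0 i|) -> F t = +oo%E) ->
  (\int[mu]_(t in `[a, b]) F^\+ t < +oo)%E ->
  forall s, a <= s <= a + h -> forall i, `|x s ord0 i - x a ord0 i| <= C * (s - a).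
Proof.
move=> ab acx C0 ahb Chr FP Foo.
have [d [Z [id dE mZ Z0 ZP]]] := abs_cont_FTC ab acx.
have inside s : a <= s <= a + h ->
    (forall u, a <= u < s -> forall i, `|x u ord0 i - x a ord0 i| < r) ->
    forall i, `|x s ord0 i - x a ord0 i| <= C * (s - a).
  move=> /andP[as_ sah] us i; have sb := le_trans sah ahb.
  have mi : measurable_fun setT (fun t => d t ord0 i).
    by apply/measurable_EFinP; exact: measurable_int (id i).
  (* The times of excessive speed in coordinate [i]: the integrand is [+oo] there, so the finite
     integral makes this set null. *)
  pose E := `]a, s[%classic `&` [set t | C < `|d t ord0 i|] `\` Z.
  have mE : measurable E.
    apply: measurableD => //.
    rewrite (_ : [set t | _] = setT `&` (fun t => `|d t ord0 i|) @^-1` `]C, +oo[).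
      apply: measurableI; first exact: measurable_itv.
      have mabs : measurable_fun setT (fun t => `|d t ord0 i|).
        exact: measurableT_comp.
      by apply: mabs => //; exact: measurable_itv.
    by apply/seteqP; split => t /=; rewrite in_itv/= andbT; [split|case].
  have E0 : mu E = 0%E.
    apply: (@lower_integral_pinfty_null _ _ _ mu `[a, b]%classic E F) => //.
      move=> t [[/=]]; rewrite !in_itv/= => /andP[/ltW -> ts] _ _ /=.
      by rewrite (le_trans (ltW ts)).
    move=> t [[/=]]; rewrite in_itv/= => /andP[at_ ts] Cd Zt.
    have tb := lt_le_trans ts sb.
    apply: FP; first by rewrite at_.
      by apply: us; rewrite ltW.
    by exists i; rewrite ZP// at_.
  have iabs : mu.-integrable `[a, s[ (EFin \o (fun t => `|d t ord0 i|)).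
    by apply: integrable_norm; exact: integrableS (id i).
  rewrite -lee_fin -abse_EFin -dE ?as_//.
  apply: le_trans (le_abse_integral _ _ _) _ => //.
    exact/measurable_EFinP/measurable_funTS.
  apply: le_trans (@le_lower_integral_off_null _ _ _ mu `[a, s[%classic
     (E `|` Z `|` [set a]) (fun t => `|d t ord0 i|) (cst C%:E) _ _ _ iabs _) _ => //.
  - by apply: measurableU => //; exact: measurableU.
  - apply: lebesgue_measureU0 => //; first exact: measurableU.
      exact: lebesgue_measureU0.
    exact: lebesgue_measure_set1.
  - move=> t /=; rewrite in_itv/= => /andP[at_ ts] /not_orP[/not_orP[Et Zt] ta].
    rewrite lee_fin leNgt; apply/negP => Cd; apply: Et; split => //; split => //=.
    by rewrite in_itv/= ts lt_neqAle at_ eq_sym !andbT; apply/eqP.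
  - by rewrite integral_cst//= lebesgue_measure_itvco.
have small s : a <= s <= a + h -> forall i, `|x s ord0 i - x a ord0 i| < r.
  move=> sah i; rewrite ltNge; apply/negP => ri.
  (* The infimum [tau] of the exit times obeys the bound by [inside]; absolute continuity on the
     single interval [[tau, u]], with tolerance [r - C * h], then forbids an exit at a time [u]
     close to [tau]. *)
  pose S := [set u | a <= u <= a + h /\ exists i, r <= `|x u ord0 i - x a ord0 i|].
  have S0 : S !=set0 by exists s; split => //; exists i.
  have lbS : has_lbound S by exists a => u [/andP[]].
  have infS : has_inf S by split.
  set tau := inf S.
  have atau : a <= tau by apply: lb_le_inf => // u [/andP[]].
  have taus : tau <= s by apply: ge_inf => //; split => //; exists i.
  have tauh : a <= tau <= a + h by rewrite atau (le_trans taus)//; case/andP: sah.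
  have before u : a <= u < tau -> forall j, `|x u ord0 j - x a ord0 j| < r.
    move=> /andP[au ut] j; rewrite ltNge; apply/negP => ru.
    have : tau <= u.
      apply: ge_inf => //; split; last by exists j.
      by rewrite au (le_trans (ltW ut))//; case/andP: tauh.
    by rewrite leNgt ut.
  have attau := inside tau tauh before.
  have [e e0 He] := acx (r - C * h) ltac:(by rewrite subr_gt0).
  have [u [uah [j ru]] ue] := inf_adherent e0 infS.
  have tauu : tau <= u by apply: ge_inf => //; split => //; exists j.
  have := He 1%N (fun=> tau) (fun=> u) (fun _ _ => tauu)
    (fun _ h => False_ind _ (Bool.diff_false_true h)) isT atau.
  have ub : u <= b by case/andP : uah => _ uah; exact: le_trans ahb.
  rewrite !big_ord1 => /(_ ub); rewrite ltrBlDl => /(_ ue) small_u.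
  have := enorm_coord (x u - x tau) j; rewrite !mxE => xut.
  have := attau j; have := ler_normD (x u ord0 j - x tau ord0 j) (x tau ord0 j - x a ord0 j).
  rewrite addrA subrK => tri taua.
  have : C * (tau - a) <= C * h by rewrite ler_wpM2l//; case/andP: tauh; lra.
  lra.
by move=> s sah; apply: inside => // u /andP[au us]; apply: small;
  rewrite au (le_trans (ltW us))//; case/andP: sah.
Qed.

End trajectories.

Local Open Scope ereal_scope.

(** * Local bounds on the Lagrangian *)

Section lagrangian.
Variables (R : realType) (N : nat) (T : R).
Variable L : R -> 'rV[R]_N -> 'rV[R]_N -> \bar R.
Hypothesis L1 : forall (t : R) (x v : 'rV[R]_N), t \in `[0%R, T] ->
     forall a : R, a%:E < L t x v ->
     exists2 U, nbhs (t, x, v) U &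
       forall z : R * 'rV[R]_N * 'rV[R]_N, U z -> z.1.1 \in `[0%R, T] ->
         a%:E < L z.1.1 z.1.2 z.2.
Hypothesis L2 : forall (t : R) (x : 'rV[R]_N), t \in `[0%R, T] ->
     [/\ forall v, L t x v != -oo,
         exists v, L t x v != +oo &
         forall (v w : 'rV[R]_N) (lam : R), (0 < lam < 1)%R ->
           L t x (lam *: v + (1 - lam) *: w)%R
             <= lam%:E * L t x v + (1 - lam)%:E * L t x w].
Hypothesis L4 : forall r : R, (0 <= r)%R -> exists2 C : R, (0 <= C)%R &
     forall (t : R) (x v : 'rV[R]_N), t \in `[0%R, T] ->
       (enorm x <= r)%R -> (C < enorm v)%R -> L t x v = +oo.

(** Obtained from (L4) on the ball of radius [enorm x0 + 1], with norms replaced by coordinates,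
    whose boxes are compact. *)
Lemma local_speed_bound (x0 : 'rV[R]_N) :
  exists C r : R, [/\ (0 <= C)%R, (0 < r)%R &
    forall t (y v : 'rV[R]_N), t \in `[0%R, T] ->
      (forall i, `|y ord0 i - x0 ord0 i| < r)%R ->
      (exists i, C < `|v ord0 i|)%R -> L t y v = +oo].
Proof.
have [C C0 CP] := L4 (addr_ge0 (sqrtr_ge0 _ : 0 <= enorm x0)%R ler01).
have : \forall y \near x0, (enorm y < enorm x0 + 1)%R.
  apply: (@cvgr_lt _ _ (nbhs x0) _ (@enorm R N) (enorm x0)); last by rewrite ltrDl.
  exact: enorm_continuous.
move=> /near_rVP[r r0 rP]; exists C, r; split => // t y v tT yr [i Ci].
by apply: CP => //; [exact/ltW/rP|exact: lt_le_trans Ci (enorm_coord _ _)].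
Qed.

(* The affine minorant of [L t0 x0] survives near [(t0, x0)] by compactness of
   the set of admissible velocities. *)
Lemma local_affine_minorant (t0 : R) (x0 v0 : 'rV[R]_N) (a : R) :
  t0 \in `[0%R, T] -> a%:E < L t0 x0 v0 ->
  exists p, exists2 r : R, (0 < r)%R & forall t (y w : 'rV[R]_N),
    t \in `[0%R, T] -> (`|t - t0| < r)%R ->
    (forall i, `|y ord0 i - x0 ord0 i| < r)%R ->
    (a + dot p (w - v0))%:E <= L t y w.
Proof.
move=> t0T av0; have [C [r [C0 r0 CP]]] := local_speed_bound x0.
have [lNy lfin lcvx] := L2 x0 t0T.
have [|v /CP|p pP] := affine_minorant lNy lfin lcvx _ _ av0 (C := C).
- move=> v b /(L1 t0T)[U [[P1 P2] [/= n1 n2] PU] UP].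
  apply: filterS n2 => w P2w; apply: (UP (t0, x0, w)) => //; apply: PU; split => //=.
  exact: nbhs_singleton.
- by apply => // i; rewrite subrr normr0.
exists p.
pose K := [set v : 'rV[R]_N | forall i, `|v ord0 i| <= C]%R.
have cov : \forall z \near nbhs (t0, x0), K `<=` [set w | z.1 \in `[0%R, T] ->
    (a + dot p (w - v0))%:E < L z.1 z.2 w].
  have /compact_near_coveringP := @box_compact R N C.
  apply => w _ /=.
  (* A real [c] strictly between the minorant and [L t0 x0] at [w] keeps separating them for nearby
     velocities, times and positions. *)
  have [c /andP[c1 c2]] := lte_EFin_between (pP w).
  have [U [[P1 P2] /= [n1 n2] PU] UP] := L1 t0T c2.
  have cd : (fun w => a + dot p (w - v0))%R @ w --> (a + dot p (w - v0))%R.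
    apply: (@cvgD _ _ _ (nbhs w) _ (fun=> a) (fun w => dot p (w - v0))).
      exact: (@cvg_cst _ a _ (nbhs w) _).
    apply: (@dot_cvg _ _ (fun=> p) (fun w => w - v0)%R).
      exact: (@cvg_cst _ p _ (nbhs w) _).
    exact: subr_cst_continuous.
  rewrite lte_fin in c1.
  have n3 := @cvgr_lt _ _ (nbhs w) _ _ _ cd _ c1.
  exists (P2 `&` [set w | (a + dot p (w - v0) < c)%R], P1) => /=.
    split; last exact: n1.
    apply: (@filterI _ (nbhs w) _ P2); [exact: n2|exact: n3].
  move=> [w' [t y]] /= [[P2w w'c] P1ty] tT.
  apply: (@lt_trans _ _ c%:E); first by rewrite lte_fin.
  by apply: (UP (t, y, w')) => //; exact: PU.
have [[P1 P2] /= [n1 n2] PU] := cov.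
have [r1 r10 r1P] : exists2 r1 : R, (0 < r1)%R & forall t, (`|t - t0| < r1)%R -> P1 t.
  move/nbhs_ballP : n1 => [r1 /= r10 rP]; exists r1 => // t tr; apply: rP.
  by rewrite /ball/= distrC.
have [r2 r20 r2P] := near_rVP n2.
exists (Num.min r (Num.min r1 r2)); first by rewrite !lt_min r0 r10.
move=> t y w tT; rewrite !lt_min => /and3P[_ tr1 _] yr.
have {}yr i : [&& `|y ord0 i - x0 ord0 i| < r, `|y ord0 i - x0 ord0 i| < r1
  & `|y ord0 i - x0 ord0 i| < r2]%R by rewrite -!lt_min.
have [wK|nK] := pselect (K w).
  apply/ltW; apply: (PU (t, y) _ w wK) => //; split => /=; first exact: r1P.
  by apply: r2P => i; have /and3P[] := yr i.
(* Outside the box the velocity is inadmissible and [L] is [+oo]. *)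
rewrite (CP t y w) ?leey//; first by move=> i; have /and3P[] := yr i.
by move/existsNP : nK => [i /negP]; rewrite -ltNge => Ci; exists i.
Qed.

End lagrangian.

(** * Dynamic programming along nearly optimal trajectories *)

(** The restriction of [x] to [[t0 + h, T]] competes for the value at its starting point, so the
    value grows by at most [h ^ 2] minus the cost over [[t0, t0 + h[]; division by [h] leaves the
    error [h]. *)
Lemma value_fun_quotient_le (R : realType) (N : nat) (T : R)
  (L : R -> 'rV[R]_N -> 'rV[R]_N -> \bar R) (g : 'rV[R]_N -> \bar R)
  (t0 h : R) (x0 : 'rV[R]_N) (x : R -> 'rV[R]_N) :
  (forall y, g y != -oo) -> t0 \in `[0%R, T[ -> (0 < h)%R -> (t0 + h < T)%R ->
  value_fun T L g t0 x0 \is a fin_num -> abs_cont t0 T x -> x t0 = x0 ->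
  g (x T) + \int[lebesgue_measure]_(t in `[t0, T]) L t (x t) (derive1 x t) <
    value_fun T L g t0 x0 + (h ^+ 2)%:E ->
  let F t := L t (x t) (derive1 x t) in
  [/\ \int[lebesgue_measure]_(t in `[t0, T]) F^\+ t < +oo,
    \int[lebesgue_measure]_(t in `[t0, (t0 + h)%R[) F t \is a fin_num &
  (value_fun T L g (t0 + h)%R (x (t0 + h)%R) - value_fun T L g t0 x0) * (h^-1)%:E
    <= (h - fine (\int[lebesgue_measure]_(t in `[t0, (t0 + h)%R[) F t) / h)%:E].
Proof.
move=> gNy ht0 h0 hT Vfin acx xt0 cost F.
have /andP[t00 t0T] : (0 <= t0 < T)%R by rewrite in_itv in ht0.
have costge : value_fun T L g t0 x0 <= g (x T) + \int[lebesgue_measure]_(t in `[t0, T]) F t.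
  rewrite /value_fun in_itv/= t00 t0T; apply: ereal_inf_lbound.
  by exists x.
(* The cost lies between the finite value and that value plus [h ^ 2]; being finite, it has finite
   terms. *)
have costfin : g (x T) + \int[lebesgue_measure]_(t in `[t0, T]) F t \is a fin_num.
  rewrite fin_numElt (lt_le_trans _ costge) ?(lt_trans cost)//.
    by rewrite -(fineK Vfin) -EFinD ltry.
  by rewrite ltNye; move: Vfin; rewrite fin_numE => /andP[].
move: (costfin); rewrite fin_numD => /andP[gfin Ifin].
have split_itv : `[t0, T]%classic =
    `[t0, (t0 + h)%R[%classic `|` `[(t0 + h)%R, T]%classic.
  by rewrite -itv_bndbnd_setU// bnd_simp; lra.
have disj : [disjoint `[t0, (t0 + h)%R[%classic & `[(t0 + h)%R, T]%classic].
  apply/disj_setPS => u [] /=; rewrite !in_itv/= => /andP[_ uh] /andP[hu _].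
  by move: (lt_le_trans uh hu); rewrite ltxx.
move: (Ifin); rewrite split_itv => Ifin'.
have := @lower_integral_setU _ _ R (@lebesgue_measure R) `[t0, (t0 + h)%R[%classic
  `[(t0 + h)%R, T]%classic F (measurable_itv _) (measurable_itv _) disj Ifin'.
rewrite -split_itv => -[Foo I1 I2 IE]; split => //.
have V1 : value_fun T L g (t0 + h)%R (x (t0 + h)%R) <=
    g (x T) + \int[lebesgue_measure]_(t in `[(t0 + h)%R, T]) F t.
  rewrite {1}/value_fun ifT; last by rewrite in_itv/= hT andbT addr_ge0// ltW.
  apply: ereal_inf_lbound; exists x => //; split => //.
  by apply: abs_cont_sub acx => //; rewrite lerDl ltW.
have {}cost : g (x T) + \int[lebesgue_measure]_(t in `[t0, T]) F t <
    value_fun T L g t0 x0 + (h ^+ 2)%:E := cost.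
move: cost V1; rewrite IE -(fineK gfin) -(fineK Vfin) -(fineK I1) -(fineK I2).
rewrite -!EFinD lte_fin => cost V1.
have V1' : value_fun T L g (t0 + h)%R (x (t0 + h)%R) - (fine (value_fun T L g t0 x0))%:E
    <= (h ^+ 2 - fine (\int[lebesgue_measure]_(t in `[t0, (t0 + h)%R[) F t))%:E.
  rewrite leeBlDr// -EFinD; apply: le_trans V1 _.
  by rewrite lee_fin; move: cost; lra.
have hV0 : 0 <= (h^-1)%:E by rewrite lee_fin invr_ge0 ltW.
apply: le_trans (lee_wpmul2r hV0 V1') _.
by rewrite -EFinM lee_fin mulrBl expr2 mulfK// gt_eqF.
Qed.

(** * Cluster points of mean velocities *)

Theorem theorem5p2 (R : realType) (N : nat) (T : R) (hT : (0 < T)%R)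
  (L : R -> 'rV[R]_N -> 'rV[R]_N -> \bar R) (g : 'rV[R]_N -> \bar R)
  (* (L1) lower semicontinuity on [0,T] x R^N x R^N *)
  (L1 : forall (t : R) (x v : 'rV[R]_N), t \in `[0%R, T] ->
     forall a : R, a%:E < L t x v ->
     exists2 U, nbhs (t, x, v) U &
       forall z : R * 'rV[R]_N * 'rV[R]_N, U z -> z.1.1 \in `[0%R, T] ->
         a%:E < L z.1.1 z.1.2 z.2)
  (* (L2) L(t,x,.) convex and proper *)
  (L2 : forall (t : R) (x : 'rV[R]_N), t \in `[0%R, T] ->
     [/\ forall v, L t x v != -oo,
         exists v, L t x v != +oo &
         forall (v w : 'rV[R]_N) (lam : R), (0 < lam < 1)%R ->
           L t x (lam *: v + (1 - lam) *: w)%R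
             <= lam%:E * L t x v + (1 - lam)%:E * L t x w])
  (* (L3) *)
  (L3 : forall (t : R) (x v : 'rV[R]_N), t \in `[0%R, T] ->
     forall (tn : nat -> R) (xn : nat -> 'rV[R]_N),
       (forall n, tn n \in `[0%R, T]) ->
       tn @ \oo --> t -> xn @ \oo --> x ->
       exists vn : nat -> 'rV[R]_N,
         vn @ \oo --> v /\ (fun n => L (tn n) (xn n) (vn n)) @ \oo --> L t x v)
  (* (L4) *)
  (L4 : forall r : R, (0 <= r)%R -> exists2 C : R, (0 <= C)%R &
     forall (t : R) (x v : 'rV[R]_N), t \in `[0%R, T] ->
       (enorm x <= r)%R -> (C < enorm v)%R -> L t x v = +oo)
  (* (L5) *)
  (L5 : exists c : R -> R,
     [/\ forall t, t \in `[0%R, T] -> (0 <= c t)%R,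
         (@lebesgue_measure R).-integrable `[0%R, T] (fun t => (c t)%:E) &
         exists Nn : set R, (@lebesgue_measure R).-negligible Nn /\
           forall (t : R) (x v : 'rV[R]_N), t \in `[0%R, T] -> ~ Nn t ->
             (c t * (1 + enorm x) < enorm v)%R -> L t x v = +oo])
  (* g proper and lower semicontinuous *)
  (g_lsc : lower_semicontinuous g)
  (g_proper : (forall x, g x != -oo) /\ exists x, g x != +oo)
  (t0 : R) (x0 : 'rV[R]_N)
  (ht0 : t0 \in `[0%R, T[)
  (hdom : value_fun T L g t0 x0 \is a fin_num) :
  exists v0 : 'rV[R]_N,
    subderiv (value_fun T L g) t0 x0 1 v0 <= - L t0 x0 v0.
Proof.
have /andP[t00 t0T] : (0 <= t0 < T)%R by rewrite in_itv in ht0.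
have t0T' : t0 \in `[0%R, T] by rewrite in_itv/= t00 ltW.
have [gNy _] := g_proper.
have [C [r [C0 r0 CP]]] := local_speed_bound L4 x0.
(* The first bound keeps [t0 + h0] below [T], the second gives the inequality [C * h0 < r] needed
   for [speed_bound]; the [+ 1] covers [C = 0]. *)
pose h0 := (Num.min ((T - t0) / 2) (r / (C + 1) / 2))%R.
have C1 : (0 < C + 1)%R by rewrite ltr_wpDl.
have h00 : (0 < h0)%R by rewrite lt_min !divr_gt0// subr_gt0.
have h0T : (t0 + h0 < T)%R.
  rewrite -ltrBrDl gt_min ltr_pdivrMr// mulr_natr mulr2n ltrDl subr_gt0 t0T//.
have Ch0 : (C * h0 < r)%R.
  apply: (@le_lt_trans _ _ ((C + 1) * (r / (C + 1) / 2))%R).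
    apply: ler_pM => //; [exact: ltW|by rewrite lerDl|].
    by rewrite ge_min lexx orbT.
  by rewrite mulrA mulrC [(_ * (_ / _))%R]mulrC divfK ?gt_eqF// mulrC; lra.
pose h (n : nat) : R := (h0 / n.+1%:R)%R.
have hn0 n : (0 < h n)%R by rewrite divr_gt0.
have hn n : (h n <= h0)%R by rewrite ler_pdivrMr// ler_peMr ?ler1n// ltW.
have hTn n : (t0 + h n < T)%R by apply: le_lt_trans h0T; rewrite lerD2l.
have /choice[x xP] : forall n, exists x : R -> 'rV[R]_N, [/\ abs_cont t0 T x,
    x t0 = x0 & g (x T) + \int[lebesgue_measure]_(t in `[t0, T]) L t (x t) (derive1 x t) <
    value_fun T L g t0 x0 + (h n ^+ 2)%:E].
  move=> n; have h2 : (0 < h n ^+ 2)%R by rewrite exprn_gt0.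
  move: (hdom); rewrite {1}/value_fun ht0 => /(lb_ereal_inf_adherent h2).
  by move=> [_ [x [acx xt0] <-] cost]; exists x; split; rewrite // /value_fun ht0.
pose F n t := L t (x n t) (derive1 (x n) t).
have bound n s : (t0 <= s <= t0 + h n)%R ->
    forall i, (`|x n s ord0 i - x0 ord0 i| <= C * (s - t0))%R.
  have [acx xt0 cost] := xP n.
  have [Foo _ _] := value_fun_quotient_le gNy ht0 (hn0 n) (hTn n) hdom acx xt0 cost.
  rewrite -xt0; apply: (@speed_bound _ _ _ T _ C r (h n) (F n)) => //.
  - exact/ltW.
  - by apply: le_lt_trans Ch0; rewrite ler_wpM2l.
  move=> t /andP[tt0 tT] xr; apply: CP; first by rewrite in_itv/= (le_trans t00) ltW.
  by rewrite -xt0.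
pose v n := ((h n)^-1 *: (x n (t0 + h n)%R - x0))%R.
have vK n i : (`|v n ord0 i| <= C)%R.
  rewrite !mxE normrM normfV (gtr0_norm (hn0 n)) mulrC ler_pdivrMr//.
  have := bound n (t0 + h n)%R; rewrite lexx lerDl (ltW (hn0 n)) => /(_ isT i).
  by rewrite [(t0 + _)%R]addrC addrK.
have [|v0 [_ clv]] := @box_compact R N C (v @ \oo) _; first by exists 0%N => // n _; exact: vK.
exists v0.
apply: ge_ereal_sup => _ [e /= e0 <-].
(* If the claim failed for [e], some real [c] would lie strictly between [- L t0 x0 v0] and the
   infimum, and some [a] between [- c] and [L t0 x0 v0], so that [a + c > 0]. A difference quotient
   at most [c] will contradict this. *)
rewrite leNgt; apply/negP => /lte_EFin_between[c /andP[+ cinf]].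
rewrite lteNl => /lte_EFin_between[a /andP[ca aL]].
have [p [d d0 pP]] := local_affine_minorant L1 L2 L4 t0T' aL.
have eta0 : (0 < (a + c) / 2)%R.
  by rewrite divr_gt0// -[c]opprK subr_gt0 -lte_fin EFinN.
(* Here [e] serves the neighbourhood in the subderivative, [d] and [d / (C + 1)] the validity of the
   minorant in time and along the trajectory, and [(a + c) / 2] the error [h n]. *)
pose eps := (Num.min (Num.min e d) (Num.min (d / (C + 1)) ((a + c) / 2)))%R.
have eps0 : (0 < eps)%R by rewrite !lt_min e0 d0 eta0 divr_gt0.
pose n0 := Num.bound (h0 / eps)%R.
have heps n : (n0 <= n)%N -> (h n < eps)%R.
  move=> n0n; rewrite ltr_pdivrMr// mulrC -ltr_pdivrMr//.
  apply: (@lt_le_trans _ _ n0%:R%R); last by rewrite ler_nat leqW.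
  by rewrite archi_boundP// divr_ge0// ltW.
have cd : (fun w => dot p (w - v0))%R @ v0 --> dot p (v0 - v0)%R.
  apply: (@dot_cvg _ _ (fun=> p) (fun w => w - v0)%R).
    exact: (@cvg_cst _ p _ (nbhs v0) _).
  exact: subr_cst_continuous.
have dp0 : (- ((a + c) / 2) < dot p (v0 - v0))%R by rewrite dotBr subrr oppr_lt0.
have near_dot := @cvgr_gt _ _ (nbhs v0) _ _ _ cd _ dp0.
have near_v0 : nbhs v0 [set w | (enorm (w - v0) < e)%R /\
    (- ((a + c) / 2) < dot p (w - v0))%R].
  by apply: filterI; [exact: enorm_near|exact: near_dot].
have [|_ [[n /= n0n <-] [ve vp]]] := clv [set v n | n in [set n | (n0 <= n)%N]] _ _ near_v0.
  by exists n0 => // n /= n0n; exists n.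
have := heps n n0n; rewrite !lt_min => /andP[/andP[he hd] /andP[hdC heta]].
have [acx xt0 cost] := xP n.
have [_ Ifin quot] := value_fun_quotient_le gNy ht0 (hn0 n) (hTn n) hdom acx xt0 cost.
have hne : h n != 0%R by rewrite gt_eqF.
have xh : x n (t0 + h n)%R = (x0 + h n *: v n)%R.
  by rewrite /v scalerA divff// scale1r addrCA subrr addr0.
have I1 : ((h n * (a + dot p (v n - v0)%R))%:E <=
    \int[lebesgue_measure]_(t in `[t0, (t0 + h n)%R[) F n t)%E.
  apply: le_trans (@affine_integral_ge _ _ t0 T (x n) (t0 + h n)%R p v0 a (F n)
    t0T acx _ _).
  - rewrite lee_fin xt0 xh [(x0 + _)%R]addrC addrK dotZr dotBr.
    by rewrite [(t0 + _)%R]addrC addrK; lra.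
  - by rewrite lerDl (ltW (hn0 n)) ltW.
  - move=> t /andP[tt0 th]; apply: pP.
    + by rewrite in_itv/= (le_trans t00) ?ltW// (lt_trans th).
    + by rewrite ger0_norm ?subr_ge0 ?ltW//; lra.
    + move=> i; apply: le_lt_trans (bound n t _ i) _; first by rewrite !ltW.
      apply: (@le_lt_trans _ _ ((C + 1) * h n)%R).
        by apply: ler_pM => //; [rewrite subr_ge0 ltW|rewrite lerDl|lra].
      by rewrite mulrC -ltr_pdivlMr.
(* The quotient is at most [h n - a - dot p (v n - v0)], where [h n] and [- dot p (v n - v0)] are
   both below [(a + c) / 2]. *)
have quotc : (value_fun T L g (t0 + h n * 1)%R (x0 + h n *: v n)%R -
    value_fun T L g t0 x0) * ((h n)^-1)%:E <= c%:E.
  rewrite mulr1 -xh; apply: le_trans quot _; rewrite lee_fin.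
  move: I1; rewrite -(fineK Ifin) lee_fin mulrC -ler_pdivlMr//; lra.
move: cinf; apply/negP; rewrite -leNgt; apply: le_trans quotc.
apply: ereal_inf_lbound; exists (h n, 1%R, v n) => //=.
by rewrite (hn0 n) he subrr normr0.
Qed.
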